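(* Let $q$ be one of the four numbers $$\frac{\sqrt{3}-1}{2},\qquad \frac{3-\sqrt{5}}{2},\qquad \sqrt{2}-1,\qquad \frac{\sqrt{5}-1}{2}.$$ Then every solution $f:\mathbb{R}\to\mathbb{R}$ of Schilling's problem (for this $q$) vanishes on the set $\mathbb{Z}+q\mathbb{Z}=\{m+nq : m,n\in\mathbb{Z}\}$; that is, $f(m+nq)=0$ for all $m,n\in\mathbb{Z}$.
   Context: For a fixed real number $q\in(0,1)$, a solution of Schilling's problem is a function $f:\mathbb{R}\to\mathbb{R}$ (no regularity is assumed) such that $$f(qx)=\frac{1}{4q}\,[f(x-1)+f(x+1)+2f(x)]\quad\text{for all } x\in\mathbb{R},$$ and $$f(x)=0\quad\text{for all } x\in\mathbb{R}\text{ with } |x|>\frac{q}{1-q}.$$ *)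

(* Defs.v *)
From mathcomp Require Import all_boot all_order all_algebra.
From mathcomp Require Import reals.

Set Implicit Arguments.
Unset Strict Implicit.
Unset Printing Implicit Defensive.

Import Order.TTheory GRing.Theory Num.Theory.
Local Open Scope ring_scope.

Definition schilling_solution (R : realType) (q : R) (f : R -> R) : Prop :=
  (forall x : R,
     f (q * x) = 1 / (4 * q) * (f (x - 1) + f (x + 1) + 2 * f x)) /\
  (forall x : R, q / (1 - q) < `|x| -> f x = 0).

(* Main.v *)
Require Import Defs.
From mathcomp Require Import all_boot all_order all_algebra.
From mathcomp Require Import reals.
From mathcomp Require Import zify ring lra.

Set Implicit Arguments.
Unset Strict Implicit.
Unset Printing Implicit Defensive.

Import Order.TTheory GRing.Theory Num.Theory.
Local Open Scope ring_scope.

(** Read backwards, the functional equation expresses [f y] through the values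
    of [f] at [y / q - 1], [y / q] and [y / q + 1].  In all four cases [1 / q]
    is of the form [a + b q] with integers [a] and [b], so that these points
    stay in [Z + q Z]: from [y = m + n q] one passes to points whose
    coefficient of [q] is [b m] (lemma [null_of_row]).  Outside the interval
    [|y| <= q / (1 - q)] there is nothing to prove, and inside it [m] is close
    to [- n q], so [b m] has absolute value at most [|b| (q |n| + q / (1 - q))].
    Since [|b| q < 1], this is smaller than [|n|] as soon as [|n|] exceeds an
    explicit bound.  Hence induction on [|n|] reduces the claim to finitely many
    rows [n = const], each of which meets the support interval in finitely
    many points (lemma [rows_null]).

    In these rows the descent ends either outside the interval or in a cycle,
    and each cycle gives a homogeneous linear system that has only the zero
    solution.  The cycles that occur are the fixed points [0] and
    [q / (1 - q)], the pair of opposite points [q / (1 + q)] and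
    [- q / (1 + q)], and, for the golden ratio conjugate only, the system
    linking [0], [1], [-1], [q] and [-q].

    Because [x |-> f (- x)] is again a solution, it is convenient to speak of the
    points at which all solutions vanish: that set is symmetric, and only rows
    with [0 <= n] have to be considered. *)

(** * Common zeros of all solutions *)

Definition null (R : realType) (q x : R) : Prop :=
  forall f : R -> R, schilling_solution q f -> f x = 0.

Section CommonZeros.
Variables (R : realType) (q : R).
Hypotheses (q_gt0 : 0 < q) (q_lt1 : q < 1).

Lemma schilling_scale (f : R -> R) (z : R) : schilling_solution q f ->
  4 * q * f (q * z) = f (z - 1) + f (z + 1) + 2 * f z.
Proof.
by move=> [eqf _]; rewrite eqf; field; rewrite gt_eqF.
Qed.

Lemma schilling_opp (f : R -> R) :
  schilling_solution q f -> schilling_solution q (fun x => f (- x)).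
Proof.
move=> [eqf outf]; split=> x; last by move=> hx; apply: outf; rewrite normrN.
have -> : - (q * x) = q * (- x) by ring.
by rewrite eqf !opprD opprK [f (- x - 1) + _]addrC.
Qed.

Lemma null_opp (x : R) : null q x -> null q (- x).
Proof. by move=> nx f /schilling_opp/nx. Qed.

Lemma null_gt (x : R) : q / (1 - q) < x -> null q x.
Proof.
by move=> hx f [_ outf]; apply: outf; apply: lt_le_trans hx (ler_norm x).
Qed.

Lemma null_lt (x : R) : x < - (q / (1 - q)) -> null q x.
Proof.
by move=> hx; rewrite -[x]opprK; apply/null_opp/null_gt; rewrite ltrNr.
Qed.

Lemma null_descent (z y : R) : y = q * z ->
  null q (z - 1) -> null q z -> null q (z + 1) -> null q y.
Proof.
move=> -> nzm nz nzp f solf; have := schilling_scale z solf.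
rewrite (nzm f solf) (nz f solf) (nzp f solf) mulr0 !addr0.
by move/eqP; rewrite !mulf_eq0 (gt_eqF q_gt0) pnatr_eq0 => /eqP.
Qed.

(** The descent from [q / (1 - q)] has a single point inside the interval,
    namely itself. *)
Lemma null_endpoint : 4 * q != 1 -> null q (q / (1 - q)).
Proof.
move=> q4 f solf; set Q := q / (1 - q).
have QE : Q = q * (1 + Q) by rewrite /Q; field; rewrite gt_eqF // subr_gt0.
have := schilling_scale (1 + Q) solf; rewrite -QE.
have -> : 1 + Q - 1 = Q by ring.
rewrite (@null_gt (1 + Q + 1) _ f solf) ?(@null_gt (1 + Q) _ f solf);
  rewrite -?/Q; try lra.
rewrite mulr0 !addr0 => h; apply/eqP; move: q4.
have /eqP : (4 * q - 1) * f Q = 0 by rewrite mulrBl h; ring.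
by rewrite mulf_eq0 subr_eq0 => /orP[->|].
Qed.

(** One step of the descent leads from [P = q / (1 + q)] to
    [- P], [1 - P] and [2 - P]; when the last two are common zeros, [f P] and
    [f (- P)] are [4 q] times each other. *)
Lemma null_two_cycle : 4 * q != 1 ->
  null q (1 - q / (1 + q)) -> null q (2 - q / (1 + q)) -> null q (q / (1 + q)).
Proof.
set P := q / (1 + q) => q4 n1 n2.
have PE : P = q * (1 - P) by rewrite /P; field; rewrite gt_eqF // addr_gt0.
have step g : schilling_solution q g -> 4 * q * g P = g (- P).
  move=> solg; have := schilling_scale (1 - P) solg; rewrite -PE.
  have -> : 1 - P - 1 = - P by ring.
  have -> : 1 - P + 1 = 2 - P by ring.
  by rewrite (n1 g solg) (n2 g solg) mulr0 !addr0.
move=> f solf; have h1 := step f solf.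
have := step _ (schilling_opp solf); rewrite /= opprK => h2.
have /eqP : (4 * q - 1) * (4 * q + 1) * f P = 0.
  by transitivity (4 * q * (4 * q * f P) - f P); [ring | rewrite h1 h2 subrr].
have p4 : 0 < 4 * q + 1 by rewrite addr_gt0 // mulr_gt0.
by rewrite !mulf_eq0 subr_eq0 (negbTE q4) (gt_eqF p4) => /eqP.
Qed.

Lemma null0 : q < 2^-1 -> null q 0.
Proof.
move=> q2 f solf.
have Q1 : q / (1 - q) < 1 by rewrite ltr_pdivrMr; move: q_lt1; lra.
have := schilling_scale 0 solf; rewrite mulr0 sub0r add0r.
rewrite (@null_gt 1 Q1 f solf) (@null_lt (-1) _ f solf) ?ltrN2 // !add0r => h.
have /eqP : (4 * q - 2) * f 0 = 0 by rewrite mulrBl h subrr.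
have q4 : 4 * q - 2 < 0 by lra.
by rewrite mulf_eq0 (lt_eqF q4) => /eqP.
Qed.

Lemma nullq : q < 2^-1 -> null q q.
Proof.
move=> q2; have Q1 : q / (1 - q) < 1 by rewrite ltr_pdivrMr; move: q_lt1; lra.
apply: (@null_descent 1); rewrite ?mulr1 ?subrr //; first exact: null0.
  exact: null_gt.
by apply: null_gt; lra.
Qed.

(** * Descent along the rows of the lattice *)

Definition row_null (n : int) : Prop :=
  forall m : int, null q (m%:~R + n%:~R * q).

Lemma row_null_opp (n : int) : row_null n -> row_null (- n).
Proof.
move=> rn m; have -> : m%:~R + (- n)%:~R * q = - ((- m)%:~R + n%:~R * q) :> R.
  by rewrite !rmorphN /=; ring.
exact/null_opp/rn.
Qed.

Lemma row_null_abs (n : int) : row_null `|n|%N -> row_null n.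
Proof.
by case: n => n //= rn; rewrite NegzE; apply: row_null_opp.
Qed.

Lemma row_of_window (lo hi n : int) :
  lo%:~R + n%:~R * q < - (q / (1 - q)) -> q / (1 - q) < hi%:~R + n%:~R * q ->
  (forall m : int, lo < m < hi -> null q (m%:~R + n%:~R * q)) -> row_null n.
Proof.
move=> hlo hhi nwin m; have [lelo|ltlo] := leP m lo.
  by apply: null_lt; apply: le_lt_trans hlo; rewrite lerD2r ler_int.
have [lehi|lthi] := leP hi m; last by apply: nwin; rewrite ltlo.
by apply: null_gt; apply: lt_le_trans hhi _; rewrite lerD2r ler_int.
Qed.

Variables (a b : int).
Hypothesis invq : q * (a%:~R + b%:~R * q) = 1.

Lemma null_of_row (m n : int) :
  row_null `|(b * m)%R|%N -> null q (m%:~R + n%:~R * q).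
Proof.
move=> /row_null_abs rn; pose k := n + a * m.
apply: (@null_descent (k%:~R + (b * m)%:~R * q)); last 1 first.
- by have := rn (k + 1); rewrite intrD addrAC.
- transitivity (m%:~R * (q * (a%:~R + b%:~R * q)) + n%:~R * q).
    by rewrite invq mulr1.
  by rewrite /k intrD !intrM; ring.
- by have := rn (k - 1); rewrite intrB addrAC.
- exact: rn.
Qed.

(** The hypothesis on [N] says that the descent strictly decreases the row
    index beyond [N]; as [|b| q < 1], it suffices to ask this of row
    [N + 1]. *)
Lemma rows_null (N : nat) :
  `|b|%:~R * q < 1 :> R ->
  `|b|%:~R * (N.+1%:R * q + q / (1 - q)) < N.+1%:R :> R ->
  (forall n : nat, (n <= N)%N -> row_null n) -> forall n : int, row_null n.
Proof.
move=> bq bN base n; apply: row_null_abs; move: `|n|%N => {}n.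
elim/ltn_ind: n => n IHn; have [/base //|ltNn m] := leqP n N.
set y := _ + _.
have [/null_gt //|ley] := ltP (q / (1 - q)) y.
have [/null_lt //|gey] := ltP y (- (q / (1 - q))).
apply: null_of_row; apply: IHn.
rewrite -(ltr_nat R) -[X in X < _]/(((`|(b * m)%R|%N : nat) : int)%:~R : R).
rewrite abszE normrM intrM.
have b0 : 0 <= `|b|%:~R :> R by rewrite ler0z.
have hm : `|m|%:~R <= n%:R * q + q / (1 - q) :> R.
  have := mulr_ge0 (ler0n R n) (ltW q_gt0).
  by rewrite intr_norm ler_norml; move: ley gey; rewrite /y -pmulrn; lra.
apply: (le_lt_trans (ler_wpM2l b0 hm)).
have : N.+1%:R <= n%:R :> R by rewrite ler_nat.
move: bN bq; set Q := q / (1 - q).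
move: (`|b|%:~R) (N.+1%:R) (n%:R) => B M n' *.
nra.
Qed.

End CommonZeros.

(** * The four values of the scaling factor *)

Section FourValues.
Variables (R : realType) (q : R).
Hypothesis q_gt0 : 0 < q.

Lemma rows_null_sqrt3 : 2 * (q * q) = 1 - 2 * q -> forall n, row_null q n.
Proof.
move=> qq; have q0 := q_gt0.
have qlo : 36 / 100 < q by nra.
have qhi : q < 37 / 100 by nra.
have q1 : q < 1 by lra.
have q2 : q < 2^-1 by lra.
have q4 : 4 * q != 1 by rewrite gt_eqF //; lra.
have QE : q / (1 - q) = (2 * q + 1) / 3.
  by apply: (canLR (mulfK _)); [rewrite gt_eqF // subr_gt0 | lra].
have PE : q / (1 + q) = 1 - 2 * q.
  by apply: (canLR (mulfK _)); [rewrite gt_eqF // addr_gt0 | lra].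
have n0 := null0 q_gt0 q1 q2; have nq := nullq q_gt0 q1 q2.
have nP : null q (1 - 2 * q).
  rewrite -PE; apply: null_two_cycle => //; rewrite PE;
    by apply: null_gt => //; rewrite QE; lra.
have invq : q * (2%:~R + 2%:~R * q) = 1 by lra.
have row0 : row_null q 0.
  apply: (row_of_window (lo := -1) (hi := 1)); rewrite ?QE; try lra.
  move=> m hm; have -> : m = 0 by lia.
  by rewrite [X in null q X](_ : _ = 0); last ring.
have row1 : row_null q 1.
  apply: (row_of_window (lo := -1) (hi := 1)); rewrite ?QE; try lra.
  move=> m hm; have -> : m = 0 by lia.
  by rewrite [X in null q X](_ : _ = q); last ring.
have row2 : row_null q 2.
  apply: (row_of_window (lo := -2) (hi := 0)); rewrite ?QE; try lra.
  move=> m hm; have -> : m = -1 by lia.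
  rewrite [X in null q X](_ : _ = - (1 - 2 * q)); last ring.
  exact: null_opp.
have row3 : row_null q 3.
  apply: (row_of_window (lo := -2) (hi := 0)); rewrite ?QE; try lra.
  move=> m hm; have -> : m = -1 by lia.
  exact: (null_of_row q_gt0 invq).
have row4 : row_null q 4.
  apply: (row_of_window (lo := -3) (hi := 0)); rewrite ?QE; try lra.
  move=> m hm; have [->|->] : m = -1 \/ m = -2 by lia.
    exact: (null_of_row q_gt0 invq).
  (* The next points are [- 4 q] and its two neighbours; only [1 - 4 q] lies in
     the support interval, and it is in the row opposite to [4]. *)
  apply: (@null_descent _ _ q_gt0 (- 4 * q)); first by lra.
  - by apply: null_lt => //; rewrite QE; lra.
  - by apply: null_lt => //; rewrite QE; lra.
  - rewrite [X in null q X](_ : _ = - ((-1)%:~R + 4%:~R * q)); last ring.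
    by apply: null_opp; exact: (null_of_row q_gt0 invq).
apply: (rows_null q_gt0 invq (N := 4)); rewrite ?QE ?normr_nat; try lra.
by do 5![case=> //].
Qed.

Lemma rows_null_3_sqrt5 : q < 1 -> q * q = 3 * q - 1 -> forall n, row_null q n.
Proof.
move=> q1 qq; have q0 := q_gt0.
have qlo : 38 / 100 < q by nra.
have qhi : q < 39 / 100 by nra.
have q2 : q < 2^-1 by lra.
have q4 : 4 * q != 1 by rewrite gt_eqF //; lra.
have QE : q / (1 - q) = 1 - q.
  by apply: (canLR (mulfK _)); [rewrite gt_eqF // subr_gt0 | lra].
have n0 := null0 q_gt0 q1 q2; have nq := nullq q_gt0 q1 q2.
have invq : q * (3%:~R + (-1)%:~R * q) = 1 by lra.
apply: (rows_null q_gt0 invq (N := 1)); rewrite ?QE ?normrN1; try lra.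
move=> [_|[_|//]].
  apply: (row_of_window (lo := -1) (hi := 1)); rewrite ?QE; try lra.
  move=> m hm; have -> : m = 0 by lia.
  by rewrite [X in null q X](_ : _ = 0); last ring.
apply: (row_of_window (lo := -2) (hi := 1)); rewrite ?QE; try lra.
move=> m hm; have [->|->] : m = 0 \/ m = -1 by lia.
  by rewrite [X in null q X](_ : _ = q); last ring.
rewrite [X in null q X](_ : _ = - (1 - q)); last ring.
by apply: null_opp; rewrite -QE; exact: null_endpoint.
Qed.

Lemma rows_null_sqrt2 : q * q = 1 - 2 * q -> forall n, row_null q n.
Proof.
move=> qq; have q0 := q_gt0.
have qlo : 41 / 100 < q by nra.
have qhi : q < 42 / 100 by nra.
have q1 : q < 1 by lra.
have q2 : q < 2^-1 by lra.
have QE : q / (1 - q) = (1 + q) / 2.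
  by apply: (canLR (mulfK _)); [rewrite gt_eqF // subr_gt0 | lra].
have n0 := null0 q_gt0 q1 q2; have nq := nullq q_gt0 q1 q2.
have invq : q * (2%:~R + 1%:~R * q) = 1 by lra.
apply: (rows_null q_gt0 invq (N := 1)); rewrite ?QE ?normr1; try lra.
move=> [_|[_|//]].
  apply: (row_of_window (lo := -1) (hi := 1)); rewrite ?QE; try lra.
  move=> m hm; have -> : m = 0 by lia.
  by rewrite [X in null q X](_ : _ = 0); last ring.
apply: (row_of_window (lo := -2) (hi := 1)); rewrite ?QE; try lra.
move=> m hm; have [->|->] : m = 0 \/ m = -1 by lia.
  by rewrite [X in null q X](_ : _ = q); last ring.
(* The next points are [- 1 - q] and its two neighbours [- 2 - q] and [- q]. *)
apply: (null_descent q_gt0 (z := - 1 - q)); first by lra.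
- by apply: null_lt; rewrite QE; lra.
- by apply: null_lt; rewrite QE; lra.
- by rewrite [X in null q X](_ : _ = - q); [exact: null_opp | ring].
Qed.

(** For the golden ratio conjugate [1 + q] is both [q / (1 - q)] and [1 / q], so
    the descent from [1] reaches [q] and the null point [1 + q], while the one
    from [q] reaches [0] and [1].  With the equation at [0] this gives a linear
    system for the values at [0], [1], [-1], [q], [-q]. *)
Lemma null_golden_cycle : q * q = 1 - q -> [/\ null q 0, null q 1 & null q q].
Proof.
move=> qq; have q0 := q_gt0.
have qlo : 61 / 100 < q by nra.
(* Reduced by [q^2 = 1 - q], the system is singular only if [76 q = 47]. *)
have qhi : q < 47 / 76 by nra.
have q1 : q < 1 by lra.
have q4 : 4 * q != 1 by rewrite gt_eqF //; lra.
have QE : q / (1 - q) = 1 + q.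
  by apply: (canLR (mulfK _)); [rewrite gt_eqF // subr_gt0 | lra].
have nQ : null q (1 + q) by rewrite -QE; exact: null_endpoint.
have n2 : null q 2 by apply: null_gt => //; rewrite QE; lra.
have n2q : null q (2 + q) by apply: null_gt => //; rewrite QE; lra.
have at1 f : schilling_solution q f -> 4 * q * f 1 = f q.
  move=> solf; have := schilling_scale q_gt0 (1 + q) solf.
  have -> : q * (1 + q) = 1 by lra.
  have -> : 1 + q - 1 = q by ring.
  have -> : 1 + q + 1 = 2 + q by ring.
  by rewrite (n2q f solf) (nQ f solf) mulr0 !addr0.
have atq f : schilling_solution q f -> 4 * q * f q = f 0 + 2 * f 1.
  move=> solf; have := schilling_scale q_gt0 1 solf.
  have -> : 1 + 1 = 2 :> R by ring.
  by rewrite mulr1 subrr (n2 f solf) addr0.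
have at0 f : schilling_solution q f -> 4 * q * f 0 = f (- 1) + f 1 + 2 * f 0.
  by move=> solf; have := schilling_scale q_gt0 0 solf;
    rewrite mulr0 sub0r add0r.
(* Eliminating [f q] shows that [f 0] is the same multiple of [f 1] and of
   [f (- 1)], both [f] and its reflection being solutions. *)
have f01 f : schilling_solution q f -> f 0 = (14 - 16 * q) * f 1.
  move=> solf; have e1 := at1 f solf; have eq := atq f solf.
  have -> : f 0 = 4 * q * (4 * q * f 1) - 2 * f 1 by rewrite e1 eq; ring.
  transitivity ((16 * (q * q) - 2) * f 1); first by ring.
  by rewrite qq; ring.
have n1 : null q 1.
  move=> f solf; have e := f01 f solf.
  have := f01 _ (schilling_opp solf); rewrite /= oppr0 => e'.
  have fN1 : f (- 1) = f 1.
    have c0 : 14 - 16 * q != 0 by rewrite gt_eqF //; lra.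
    by apply: (mulfI c0); rewrite -e -e'.
  have /eqP : (76 * q - 47) * (4 * f 1) = 0.
    have := at0 f solf; rewrite fN1 e => h.
    (* Twice the equation at [0], in terms of [f 1] and with [q^2] reduced. *)
    have -> : (76 * q - 47) * (4 * f 1) =
      2 * (4 * q * ((14 - 16 * q) * f 1)
           - (f 1 + f 1 + 2 * ((14 - 16 * q) * f 1)))
      + 128 * (q * q - (1 - q)) * f 1 by ring.
    by rewrite h qq !subrr !mulr0 mul0r addr0.
  have c0 : 76 * q - 47 < 0 by lra.
  by rewrite !mulf_eq0 (lt_eqF c0) pnatr_eq0 => /eqP.
split=> // f solf; first by rewrite (f01 f solf) (n1 f solf) mulr0.
by rewrite -(at1 f solf) (n1 f solf) mulr0.
Qed.

Lemma rows_null_golden : q * q = 1 - q -> forall n, row_null q n.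
Proof.
move=> qq; have [n0 n1 nq] := null_golden_cycle qq; have q0 := q_gt0.
have qlo : 61 / 100 < q by nra.
have qhi : q < 62 / 100 by nra.
have q1 : q < 1 by lra.
have q4 : 4 * q != 1 by rewrite gt_eqF //; lra.
have QE : q / (1 - q) = 1 + q.
  by apply: (canLR (mulfK _)); [rewrite gt_eqF // subr_gt0 | lra].
have PE : q / (1 + q) = 1 - q.
  by apply: (canLR (mulfK _)); [rewrite gt_eqF // addr_gt0 | lra].
have nQ : null q (1 + q) by rewrite -QE; exact: null_endpoint.
have nP : null q (1 - q).
  rewrite -PE; apply: null_two_cycle => //; rewrite PE.
    by rewrite [X in null q X](_ : _ = q); last ring.
  by rewrite [X in null q X](_ : _ = 1 + q); last ring.
have invq : q * (1%:~R + 1%:~R * q) = 1 by lra.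
(* From [k q - k] the next points are [- k q] and its neighbours. *)
have diag (k : int) : 2%:~R <= k%:~R :> R -> null q (k%:~R * q) ->
    null q (1 - k%:~R * q) -> null q ((- k)%:~R + k%:~R * q).
  move=> k2 nk nk1; have kq : 2 * q <= k%:~R * q by rewrite ler_pM2r.
  apply: (null_descent q_gt0 (z := - (k%:~R * q))).
  - rewrite rmorphN /= mulrN mulrCA qq; ring.
  - by apply: null_lt; rewrite QE; lra.
  - exact: null_opp.
  - by rewrite addrC.
have row0 : row_null q 0.
  apply: (row_of_window (lo := -2) (hi := 2)); rewrite ?QE; try lra.
  move=> m hm; have [->|[->|->]] : m = -1 \/ m = 0 \/ m = 1 by lia.
  - by rewrite [X in null q X](_ : _ = - 1); [exact: null_opp | ring].
  - by rewrite [X in null q X](_ : _ = 0); last ring.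
  - by rewrite [X in null q X](_ : _ = 1); last ring.
have n2q : null q (2%:~R * q).
  rewrite [X in null q X](_ : _ = 0%:~R + 2%:~R * q); last ring.
  exact: (null_of_row q_gt0 invq).
have row1 : row_null q 1.
  apply: (row_of_window (lo := -3) (hi := 2)); rewrite ?QE; try lra.
  move=> m hm.
  have [->|[->|[->|->]]] : m = -2 \/ m = -1 \/ m = 0 \/ m = 1 by lia.
  - apply: (null_descent q_gt0 (z := - 1 - 2%:~R * q)); first by lra.
    + by apply: null_lt; rewrite QE; lra.
    + by apply: null_lt; rewrite QE; lra.
    + rewrite [X in null q X](_ : _ = - (2%:~R * q)); last ring.
      exact: null_opp.
  - by rewrite [X in null q X](_ : _ = - (1 - q)); [exact: null_opp | ring].
  - by rewrite [X in null q X](_ : _ = q); last ring.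
  - by rewrite [X in null q X](_ : _ = 1 + q); last ring.
have row2 : row_null q 2.
  apply: (row_of_window (lo := -3) (hi := 1)); rewrite ?QE; try lra.
  move=> m hm; have [->|[->|->]] : m = -2 \/ m = -1 \/ m = 0 by lia.
  - apply: diag => //.
    rewrite [X in null q X](_ : _ = - ((-1)%:~R + 2%:~R * q)); last ring.
    by apply: null_opp; exact: (null_of_row q_gt0 invq).
  - exact: (null_of_row q_gt0 invq).
  - exact: (null_of_row q_gt0 invq).
have row3 : row_null q 3.
  apply: (row_of_window (lo := -4) (hi := 0)); rewrite ?QE; try lra.
  move=> m hm; have [->|[->|->]] : m = -3 \/ m = -2 \/ m = -1 by lia.
  - apply: diag; [lra | by apply: null_gt; rewrite QE; lra |].
    rewrite [X in null q X](_ : _ = - ((-1)%:~R + 3%:~R * q)); last ring.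
    by apply: null_opp; exact: (null_of_row q_gt0 invq).
  - exact: (null_of_row q_gt0 invq).
  - exact: (null_of_row q_gt0 invq).
have row4 : row_null q 4.
  apply: (row_of_window (lo := -5) (hi := 0)); rewrite ?QE; try lra.
  move=> m hm.
  have [->|[->|[->|->]]] : m = -4 \/ m = -3 \/ m = -2 \/ m = -1 by lia.
  - apply: diag; [lra | by apply: null_gt; rewrite QE; lra |].
    rewrite [X in null q X](_ : _ = - ((-1)%:~R + 4%:~R * q)); last ring.
    by apply: null_opp; exact: (null_of_row q_gt0 invq).
  - exact: (null_of_row q_gt0 invq).
  - exact: (null_of_row q_gt0 invq).
  - exact: (null_of_row q_gt0 invq).
apply: (rows_null q_gt0 invq (N := 4)); rewrite ?QE ?normr1; try lra.
by do 5![case=> //].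
Qed.

End FourValues.

Theorem mainTheorem1 (R : realType) (q : R)
    (hq : [\/ q = (Num.sqrt 3 - 1) / 2, q = (3 - Num.sqrt 5) / 2,
              q = Num.sqrt 2 - 1 | q = (Num.sqrt 5 - 1) / 2])
    (f : R -> R) (hf : schilling_solution q f) (m n : int) :
  f (m%:~R + n%:~R * q) = 0.
Proof.
suff rows : forall k, row_null q k by exact: rows.
have sqrt_sq (k : nat) : Num.sqrt k%:R * Num.sqrt k%:R = k%:R :> R.
  by rewrite -expr2 sqr_sqrtr ?ler0n.
case: hq => qE.
- have := sqrt_sq 3; have := sqrtr_ge0 (3 : R);
  set s := Num.sqrt _ in qE * => s0 ss.
  by apply: rows_null_sqrt3; [nra | rewrite qE; lra].
- have := sqrt_sq 5; have := sqrtr_ge0 (5 : R);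
  set s := Num.sqrt _ in qE * => s0 ss.
  by apply: rows_null_3_sqrt5; [nra | nra | rewrite qE; lra].
- have := sqrt_sq 2; have := sqrtr_ge0 (2 : R);
  set s := Num.sqrt _ in qE * => s0 ss.
  by apply: rows_null_sqrt2; [nra | rewrite qE; lra].
- have := sqrt_sq 5; have := sqrtr_ge0 (5 : R);
  set s := Num.sqrt _ in qE * => s0 ss.
  by apply: rows_null_golden; [nra | rewrite qE; lra].
Qed.
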